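(* Let $p$ be a prime, let $K \ge 1$, $n \ge 1$ and $j$ be integers with $0 \le j \le n-1$, and let $N = Kp^n+1$. Suppose that $N \neq p^{3(n-j)}+1$, $N \neq \left(\sqrt{p^{n-j}+1}-1\right)p^{3(n-j)}+1$, $N \neq H^3p^{3(n-j)}+1$ for every positive integer $H$, and that $p^j \ge p^{2(n-j)}$, $p^{n-j} \ge (N-1)^{2/7}$ and $p^{n-j} > 11+4\sqrt{7}$. If there exist integers $a>1$ and $L$ such that: (i) $a^{Kp^{n-j-1}} \equiv L \pmod N$ and $L \not\equiv 1 \pmod N$, and (ii) $L^{p^{j+1}} \equiv 1 \pmod N$, then $N$ is prime. *)

(* Defs.v *)
From mathcomp Require Import all_boot all_order all_algebra.
From mathcomp Require Import reals exp.

(* Main.v *)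
(** With [P = p^(n-j)], the order of [a] modulo some prime power [q^e] exactly
    dividing [N] is a multiple of [P], so [q = 1 + xP], and hence the cofactor
    is [1 + yP].  Moreover [N - 1 = C P^3] with [C^2 <= P].  If [y > 0],
    expanding the product gives [x + y = sP] and [xy + s = CP], so that
    [x^2 - s = (xs - C) P].  Taking [x <= y], size considerations leave only
    [x^2 = s], whence [C = x^3], or [s = 1] and [x^2 = 1 + kP] with
    [k = x - C] in [{1, 2, 3}]: [k = 1] gives [(C + 1)^2 = P + 1], and
    [k = 2, 3] force [P <= 21 < 11 + 4 sqrt 7]. *)
Require Import Defs.
From mathcomp Require Import all_boot all_order all_algebra.
From mathcomp Require Import reals exp.
From mathcomp Require cyclic.
From mathcomp Require Import zify ring lra.
Import Order.TTheory GRing.Theory Num.Theory.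
Local Open Scope ring_scope.

(** Bezout in the form [u * d = v * e + gcdn d e] has no negative exponent, so no inverse of [a]
    enters. *)
Lemma expn_eq1_mod_gcdn (a m d e : nat) : (0 < d)%N ->
  (a ^ d = 1 %[mod m])%N -> (a ^ e = 1 %[mod m])%N ->
  (a ^ gcdn d e = 1 %[mod m])%N.
Proof.
move=> d_gt0 ad1 ae1; case: (egcdnP e d_gt0) => u v uvE _.
have pow1 k t : (a ^ k = 1 %[mod m] -> a ^ (t * k) = 1 %[mod m])%N.
  by move=> ak1; rewrite mulnC expnM -modnXm ak1 modnXm exp1n.
by rewrite -(pow1 _ u ad1) uvE expnD -modnMml (pow1 _ v ae1) modnMml mul1n.
Qed.

Lemma dvdn_muln_pfactor (p g K n c : nat) : prime p ->
  (g %| K * p ^ n)%N -> ~~ (p ^ c.+1 %| g)%N -> (g %| K * p ^ c)%N.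
Proof.
move=> p_pr g_dvd pNg.
have g_gt0 : (0 < g)%N by case: g pNg {g_dvd} => //; rewrite dvdn0.
have [g' cop gE] := pfactor_coprime p_pr g_gt0.
rewrite gE dvdn_mul //.
  have : (g' %| K * p ^ n)%N by apply: dvdn_trans g_dvd; rewrite gE dvdn_mulr.
  by rewrite Gauss_dvdl // coprime_sym coprimeXl.
by rewrite dvdn_exp2l // -ltnS ltnNge -pfactor_dvdn.
Qed.

(** A power of [a] that is not 1 modulo [N] is already not 1 modulo the [q]-part of [N] for some
    prime [q]; Euler's theorem is then applied to that part. *)
Lemma exists_prime_dvd_eq1_mod (p K n c a N : nat) : prime p -> (c < n)%N ->
  (0 < K)%N -> N = (K * p ^ n + 1)%N ->
  (a ^ (K * p ^ n) = 1 %[mod N])%N -> (a ^ (K * p ^ c) <> 1 %[mod N])%N ->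
  exists2 q, prime q & (q %| N)%N && (p ^ c.+1 %| q.-1)%N.
Proof.
move=> p_pr c_lt K_gt0 NE aN1 aNc.
have N_gt0 : (0 < N)%N by rewrite NE addn1.
have Kp_gt0 : (0 < K * p ^ n)%N by rewrite muln_gt0 K_gt0 expn_gt0 prime_gt0.
have co_Na : coprime N a.
  rewrite -(coprime_pexpr _ _ Kp_gt0) -coprime_modr aN1 coprime_modr.
  exact: coprimen1.
have a_gt0 : (0 < a)%N.
  case: (posnP a) co_Na => // ->; rewrite /coprime gcdn0 NE addn1 eqSS.
  by rewrite -leqn0 leqNgt Kp_gt0.
have eq1P m e : (m %| a ^ e - 1)%N = (a ^ e == 1 %[mod m])%N.
  by rewrite eqn_mod_dvd // expn_gt0 a_gt0.
have /dvdn_partP : ~~ (N %| a ^ (K * p ^ c) - 1)%N.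
  by rewrite eq1P; apply/eqP.
move=> /(_ N_gt0) notall.
have [/allP allq|/allPn[q qN qP]] :=
    boolP (all (fun q : nat => N`_q %| a ^ (K * p ^ c) - 1)%N (primes N)).
  by case: notall => q; exact: allq.
have /and3P[q_pr _ q_dvd] : [&& prime q, (0 < N)%N & (q %| N)%N].
  by rewrite -mem_primes.
exists q => //; rewrite q_dvd /=.
have MN : (N`_q %| N)%N := dvdn_part _ _.
have co_Ma : coprime N`_q a := coprime_dvdl MN co_Na.
have aM1 : (a ^ (K * p ^ n) = 1 %[mod N`_q])%N.
  apply/eqP; rewrite -eq1P; apply: dvdn_trans MN _.
  by rewrite eq1P; apply/eqP.
have aphi : (a ^ totient N`_q = 1 %[mod N`_q])%N.
  by apply: cyclic.Euler_exp_totient; rewrite coprime_sym.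
have phi_gt0 : (0 < totient N`_q)%N by rewrite totient_gt0 part_gt0.
have ag := expn_eq1_mod_gcdn _ _ _ _ phi_gt0 aphi aM1.
(* Otherwise this gcd would divide [K * p ^ c], forcing [a ^ (K * p ^ c)] to be 1 modulo the
   [q]-part. *)
have pg : (p ^ c.+1 %| gcdn (totient N`_q) (K * p ^ n))%N.
  apply: contraNT qP => pNg.
  have /dvdnP[t ->] := dvdn_muln_pfactor _ _ _ _ _ p_pr (dvdn_gcdr _ _) pNg.
  by rewrite eq1P mulnC expnM -modnXm ag modnXm exp1n.
(* This removes the power of [q] from the totient, leaving [q.-1]. *)
have co_pq : coprime p q.
  rewrite prime_coprime // dvdn_prime2 //; apply/eqP => pq.
  move: q_dvd; rewrite -pq NE dvdn_addr ?dvdn_mull ?dvdn_exp //; last first.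
    exact: leq_ltn_trans c_lt.
  by rewrite dvdn1; case: eqP p_pr => // ->.
have := dvdn_trans pg (dvdn_gcdl _ _).
rewrite p_part totient_pfactor ?logn_gt0 // Gauss_dvdl //.
exact/coprimeXl/coprimeXr.
Qed.

Lemma cube_or_near_square (P C x y : nat) : (0 < x)%N -> (0 < y)%N ->
  (21 < P)%N -> (C ^ 2 <= P)%N -> (x + y + x * y * P = C * P ^ 2)%N ->
  C = (x ^ 3)%N \/ C = (y ^ 3)%N \/ ((C + 1) ^ 2 = P + 1)%N.
Proof.
wlog le_xy : x y / (x <= y)%N => [wl x0 y0 P_gt CP E|x_gt0 y_gt0 P_gt CP E].
  have [le_xy|/ltnW le_yx] := leqP x y; first exact: wl.
  have E' : (y + x + y * x * P = C * P ^ 2)%N by rewrite addnC mulnC -E; lia.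
  by have := wl y x le_yx y0 x0 P_gt CP E'; tauto.
have /dvdnP[s sE] : (P %| x + y)%N.
  rewrite -(dvdn_addl _ (dvdn_mull (x * y) (dvdnn P))) E.
  by rewrite dvdn_mull // dvdn_exp.
have P_gt0 : (0 < P)%N by lia.
have s_gt0 : (0 < s)%N by case: s sE => //; lia.
have E2 : (s + x * y = C * P)%N.
  by apply/eqP; rewrite -(eqn_pmul2r P_gt0); apply/eqP; lia.
(* Multiply [x + y = s * P] by [x] and eliminate [x * y] with [E2]. *)
have E3 : (x * s * P + s = C * P + x ^ 2)%N by nia.
(* Since [x <= y], [x * s * P = x ^ 2 + x * y <= 2 * x * y < 2 * C * P]. *)
have xs_lt : (x * s < 2 * C)%N.
  by rewrite -(ltn_pmul2r P_gt0); nia.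
have [lt_Cxs|gt_Cxs|eq_Cxs] := ltngtP C (x * s)%N; last first.
- by left; have sx : s = (x ^ 2)%N by [nia]; rewrite eq_Cxs sx; lia.
- exfalso.
  (* The contradiction is [P <= s <= x * s < C <= C ^ 2 <= P]. *)
  have : (P <= s)%N by nia.
  have : (s <= x * s)%N by nia.
  nia.
have [k kE] : exists k, (x * s = C + k)%N by exists (x * s - C)%N; lia.
have k_gt0 : (0 < k)%N by lia.
have E4 : (x ^ 2 = s + k * P)%N by nia.
have xs2 : ((x * s) ^ 2 < 4 * P)%N.
  apply: (@leq_trans ((2 * C) ^ 2)); first by rewrite ltn_exp2r.
  by rewrite expnMn leq_mul2l.
(* If [s >= 2], then [4 * x ^ 2 <= (x * s) ^ 2 < 4 * P], against [x ^ 2 > P]. *)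
have s1 : s = 1%N.
  have [s2|] := ltnP 1 s; last lia.
  have : (P < x ^ 2)%N by have := leq_pmull P k_gt0; lia.
  have : (4 * x ^ 2 <= (x * s) ^ 2)%N.
    rewrite expnMn mulnC leq_mul2l; apply/orP; right.
    by rewrite (leq_exp2r 2 s (ltn0Sn 1)).
  lia.
subst s; rewrite !muln1 in kE xs2.
have k_lt4 : (k < 4)%N by rewrite -(ltn_pmul2r P_gt0); lia.
(* The case [k = 1] is closed by [lia]; [k = 2] and [k = 3] remain. *)
case: k => [|[|[|[|k]]]] in kE k_gt0 E4 k_lt4 *; try lia;
  exfalso; rewrite kE in E4;
  (* Here [(C + k) ^ 2 = 1 + k * P >= 1 + k * C ^ 2] bounds [C]; each remaining value makes [P]
     smaller than 21. *)
  (have : (C <= 4)%N by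
     rewrite leqNgt; apply/negP => C_gt4; have := leq_mul C_gt4 (leqnn C); lia);
  by case: C E4 {CP E E2 E3 xs_lt lt_Cxs kE} => [|[|[|[|[|C]]]]]; lia.
Qed.

Lemma sqr_le_exp7_of_powR (R : realType) (x y : R) : 0 <= x ->
  x `^ (2 / 7) <= y -> x ^+ 2 <= y ^+ 7.
Proof.
move=> x_ge0 xy.
have -> : x ^+ 2 = (x `^ (2 / 7)) ^+ 7.
  rewrite -!powR_mulrn ?powR_ge0 // -powRrM; congr (_ `^ _); by field.
by rewrite lerXn2r // nnegrE ?powR_ge0 // (le_trans _ xy) ?powR_ge0.
Qed.

Theorem theorem3p4 (R : realType) (p K n j N : nat)
  (p_prime : prime p) (K_ge1 : (1 <= K)%N) (n_ge1 : (1 <= n)%N)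
  (j_le : (j <= n - 1)%N) (N_def : N = (K * p ^ n + 1)%N)
  (N_neq1 : N <> (p ^ (3 * (n - j)) + 1)%N)
  (N_neq2 : N%:R <> (Num.sqrt (p%:R ^+ (n - j) + 1) - 1) * p%:R ^+ (3 * (n - j)) + 1 :> R)
  (N_neq3 : forall H : nat, (0 < H)%N -> N <> (H ^ 3 * p ^ (3 * (n - j)) + 1)%N)
  (pj_ge : (p ^ (2 * (n - j)) <= p ^ j)%N)
  (pnj_ge : (N%:R - 1) `^ (2 / 7) <= p%:R ^+ (n - j) :> R)
  (pnj_gt : 11 + 4 * Num.sqrt 7 < p%:R ^+ (n - j) :> R)
  (aL : exists a L : int,
      [/\ 1 < a,
          (a ^+ (K * p ^ (n - j - 1)) = L %[mod N])%Z,
          (L <> 1 %[mod N])%Z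
        & (L ^+ (p ^ (j + 1)) = 1 %[mod N])%Z]) :
  prime N.
Proof.
have [c cE] : exists c, (n - j = c.+1)%N.
  by exists (n - j).-1; move: j_le n_ge1; clear; lia.
have nE : (n = c + (j + 1))%N by move: cE; clear; lia.
have c_lt : (c < n)%N by rewrite nE addn1 addnS ltnS leq_addr.
have pK_gt1 := prime_gt1 p_prime.
case: aL => -[a [L [_ aL L1 Lp]]|a [L []] //].
have aNc : (a ^ (K * p ^ c) <> 1 %[mod N])%N.
  move=> a1; apply: L1; rewrite -aL cE subn1 /=.
  by rewrite -!natz -natrX !natz !modz_nat a1.
have aN1 : (a ^ (K * p ^ n) = 1 %[mod N])%N.
  apply/eqP; rewrite -(eqr_nat int) !natz -!modz_nat; apply/eqP.
  rewrite -Lp -modzXm -aL modzXm cE subn1 /= -exprM -mulnA -expnD -nE.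
  by rewrite -!natz natrX.
have [q q_pr /andP[/dvdnP[m NqE] Pq]] :=
  exists_prime_dvd_eq1_mod _ _ _ _ _ _ p_prime c_lt K_ge1 N_def aN1 aNc.
have q_gt1 := prime_gt1 q_pr.
(* Then [n = 3 * c.+1 + d], which splits [P ^ 3] off [N - 1]. *)
have [d dE] : exists d, (j = 2 * c.+1 + d)%N.
  exists (j - 2 * c.+1)%N; rewrite subnKC //.
  by move: pj_ge; rewrite leq_exp2l // cE.
rewrite -!natrX !cE in N_neq2 N_neq3 pnj_ge pnj_gt.
rewrite ![(3 * _)%N]mulnC in N_neq2.
have N_neq3' H : (0 < H)%N -> N <> (H ^ 3 * (p ^ c.+1) ^ 3 + 1)%N.
  by rewrite -expnM [(c.+1 * _)%N]mulnC; exact: N_neq3.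
rewrite expnM in N_neq2.
set P := (p ^ c.+1)%N in Pq N_neq2 N_neq3' pnj_ge pnj_gt.
set C := (K * p ^ d)%N.
have NC : N = (C * P ^ 3 + 1)%N.
  rewrite N_def /C /P -expnM -mulnA -expnD; congr (_ * p ^ _ + 1)%N.
  by move: nE dE; clear; lia.
have P_gt0 : (0 < P)%N by rewrite expn_gt0 prime_gt0.
have P_gt : (21 < P)%N.
  rewrite -(ltr_nat R); apply: lt_trans pnj_gt.
  (* The bound comes from [11 + 4 * (5 / 2) = 21]. *)
  suff : 5 / 2 < Num.sqrt 7 :> R by lra.
  rewrite -(ltr_pXn2r (n := 2)) ?nnegrE ?sqrtr_ge0 ?sqr_sqrtr //; lra.
have CP : (C ^ 2 <= P)%N.
  have NR : N%:R - 1 = (C * P ^ 3)%:R :> R by rewrite NC natrD addrK.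
  (* This is [(C * P ^ 3) ^ 2 <= P ^ 7], from which [P ^ 6] cancels. *)
  have := sqr_le_exp7_of_powR _ _ _ _ pnj_ge; rewrite NR ler0n => /(_ isT).
  rewrite -!natrX ler_nat expnMn -expnM => h.
  have P6 : (0 < P ^ 6)%N by rewrite expn_gt0 P_gt0.
  by rewrite -(leq_pmul2r P6) -expnS.
case/dvdnP: Pq => x xE.
have qE : q = (x * P + 1)%N by move: q_gt1 xE; clear; lia.
have x_gt0 : (0 < x)%N by case: x xE {qE} => //; move: q_gt1; clear; lia.
have m_gt0 : (0 < m)%N by case: m NqE => //; rewrite NC addn1.
(* Both [N] and [q] are 1 modulo [P], hence so is the cofactor [m]. *)
have /dvdnP[y yE] : (P %| m - 1)%N.
  have : (P %| N - 1)%N by rewrite NC addnK dvdn_mull // dvdn_exp.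
  have -> : (N - 1 = m * x * P + (m - 1))%N by rewrite NqE qE; move: m_gt0; clear; nia.
  by rewrite dvdn_addr // dvdn_mull.
have [y0|y_gt0] := posnP y.
  have m1 : m = 1%N by move: yE m_gt0; rewrite y0; clear; lia.
  by rewrite NqE m1 mul1n.
exfalso.
have mE : m = (y * P + 1)%N by move: yE m_gt0; clear; lia.
have E : (x + y + x * y * P = C * P ^ 2)%N.
  apply/eqP; rewrite -(eqn_pmul2r P_gt0); apply/eqP.
  have : (C * P ^ 3 + 1 = (y * P + 1) * (x * P + 1))%N by rewrite -NC NqE mE qE.
  by clear; lia.
have [CE|[CE|CE]] := cube_or_near_square _ _ _ _ x_gt0 y_gt0 P_gt CP E.
- by apply: (N_neq3' x x_gt0); rewrite -CE.
- by apply: (N_neq3' y y_gt0); rewrite -CE.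
(* Here [C] is [sqrt (P + 1) - 1], the second excluded form. *)
apply: N_neq2.
have -> : (P%:R + 1 = (C + 1)%:R ^+ 2 :> R) by rewrite -natrX CE natrD.
by rewrite sqrtr_sqr ger0_norm // natrD addrK NC natrD natrM natrX.
Qed.
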